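(* Given a sequence of points $x_1,x_2,\dots$ in Euclidean $d$-space $(\mathbb{R}^d,\|\cdot\|_2)$ arriving in an online fashion, there is a stochastic online embedding into an ultrametric (a 2-HST) with expected distortion $O(\sqrt{d}\cdot\log\Phi)$, where $\Phi$ is the aspect ratio of the point set (unknown in advance).
   Context: An online embedding of a sequence $x_1,\dots,x_k$ into a metric space $(Y,d_Y)$ is a sequence of maps $f_1,\dots,f_k$, $f_i:\{x_1,\dots,x_i\}\to Y$, with $f_{i+1}$ extending $f_i$, where $f_i$ may depend only on $x_1,\dots,x_i$. It is dominating if $d_Y(f_k(x_i),f_k(x_j))\ge\|x_i-x_j\|_2$ for all $i,j$. A stochastic online embedding is a distribution over dominating online embeddings (the sequence being fixed in advance but unknown to the algorithm), with expected distortion $t$ if $\mathbb{E}[d_Y(f_k(x_i),f_k(x_j))]\le t\|x_i-x_j\|_2$ for all $i,j$. A metric $(U,d_U)$ is a $2$-HST if there is a bijection $\varphi$ from $U$ to the leaves of a rooted tree with node labels $\Gamma\ge0$, $\Gamma=0$ on leaves, $\Gamma(v)\ge2\Gamma(u)$ for every internal node $v$ and child $u$, and $d_U(x,y)=\Gamma(\mathrm{lca}(\varphi(x),\varphi(y)))$. The aspect ratio is the ratio of maximum to minimum nonzero pairwise distance. *)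

(* Defs.v *)
From HB Require Import structures.
From mathcomp Require Import all_boot all_order all_algebra.
From mathcomp Require Import all_classical all_reals all_analysis.

Set Implicit Arguments.
Unset Strict Implicit.
Unset Printing Implicit Defensive.

Import Order.TTheory GRing.Theory Num.Theory.

Local Open Scope classical_set_scope.
Local Open Scope ring_scope.

(* The library's norm on ['rV[R]_d] is the sup norm, so the Euclidean distance
   is written out. *)
Definition l2dist (R : realType) (d : nat) (x y : 'rV[R]_d) : R :=
  Num.sqrt (\sum_(i < d) (x ord0 i - y ord0 i) ^+ 2).

Definition max_dist (R : realType) (d : nat) (s : seq 'rV[R]_d) : R :=
  \big[Num.max/0]_(x <- s) \big[Num.max/0]_(y <- s) l2dist x y.

(* The neutral element [max_dist s] has no influence as soon as [s] contains two
   distinct points. *)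
Definition min_dist (R : realType) (d : nat) (s : seq 'rV[R]_d) : R :=
  \big[Num.min/max_dist s]_(x <- s)
    \big[Num.min/max_dist s]_(y <- s | x != y) l2dist x y.

(* Equal to 0 / 0 = 0 when [s] has at most one distinct point. *)
Definition aspect_ratio (R : realType) (d : nat) (s : seq 'rV[R]_d) : R :=
  max_dist s / min_dist s.

(* A finite rooted tree given by its parent map, the root being its own
   parent; reachability of the root excludes any other cycle. *)
Record rooted_tree := RootedTree {
  node :> finType;
  troot : node;
  parent : node -> node;
  parent_troot : parent troot = troot;
  troot_reachable : forall v : node, fconnect parent v troot
}.

Definition is_child (T : rooted_tree) (v u : T) : bool :=
  (u != troot T) && (parent u == v).

Definition is_leaf (T : rooted_tree) (v : T) : bool :=
  ~~ [exists u : T, is_child v u].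

(* Every node is an ancestor of itself. *)
Definition is_ancestor (T : rooted_tree) (v u : T) : bool :=
  fconnect (@parent T) u v.

Definition is_lca (T : rooted_tree) (v u w : T) : Prop :=
  [/\ is_ancestor v u, is_ancestor v w &
      forall z : T, is_ancestor z u -> is_ancestor z w -> is_ancestor z v].

(* The metric space is the subset [U] of [Y] with the induced distance.  Since
   a finite tree has a leaf, [U] is necessarily nonempty. *)
Definition is_2HST (R : realType) (Y : metricType R) (U : set Y) : Prop :=
  exists (T : rooted_tree) (Gamma : T -> R) (phi : Y -> T),
    [/\ forall v : T, 0 <= Gamma v,
        forall v : T, is_leaf v -> Gamma v = 0,
        forall v u : T, is_child v u -> 2 * Gamma u <= Gamma v,
        set_bij U [set v : T | is_leaf v] phi &
        forall x y : Y, U x -> U y ->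
          exists2 v : T, is_lca v (phi x) (phi y) & mdist x y = Gamma v].

Definition is_ultrametric (R : realType) (Y : metricType R) : Prop :=
  forall x y z : Y, mdist x z <= Num.max (mdist x y) (mdist y z).

(* A deterministic online embedding algorithm.  On input x_1, ..., x_k the map
   f_i is [emb [:: x_1; ...; x_i]], which by construction depends on
   x_1, ..., x_i only; the values of [emb s] outside of [s] are irrelevant. *)
Record online_embedding (R : realType) (d : nat) := OnlineEmbedding {
  host : metricType R;
  emb : seq 'rV[R]_d -> 'rV[R]_d -> host;
  emb_rcons : forall (s : seq 'rV[R]_d) (z x : 'rV[R]_d),
    x \in s -> emb (rcons s z) x = emb s x
}.

Definition emb_dist (R : realType) (d : nat) (f : online_embedding R d)
    (s : seq 'rV[R]_d) (x y : 'rV[R]_d) : R :=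
  mdist (emb f s x) (emb f s y).

Definition dominating (R : realType) (d : nat) (f : online_embedding R d) :
    Prop :=
  forall (s : seq 'rV[R]_d) (x y : 'rV[R]_d),
    x \in s -> y \in s -> l2dist x y <= emb_dist f s x y.

(* The number of points and their scale are unbounded, so no single rooted tree
   can serve all inputs: the host is an ultrametric space in which the image of
   every input sequence is a 2-HST. *)
Definition into_2HST (R : realType) (d : nat) (f : online_embedding R d) :
    Prop :=
  is_ultrametric (host f) /\
  (forall s : seq 'rV[R]_d, s != [::] ->
     is_2HST [set emb f s x | x in [set` s]]).

(* Measurability of the pairwise distances is what gives a meaning to their
   expectations. *)
Definition stochastic_online_embedding (R : realType) (d : nat)
    (disp : measure_display) (Omega : measurableType disp)
    (F : Omega -> online_embedding R d) : Prop :=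
  (forall w : Omega, dominating (F w)) /\
  (forall (s : seq 'rV[R]_d) (x y : 'rV[R]_d), x \in s -> y \in s ->
     measurable_fun [set: Omega] (fun w : Omega => emb_dist (F w) s x y)).

Definition expected_distortion (R : realType) (d : nat)
    (disp : measure_display) (Omega : measurableType disp)
    (P : probability Omega R) (F : Omega -> online_embedding R d)
    (s : seq 'rV[R]_d) (t : R) : Prop :=
  forall x y : 'rV[R]_d, x \in s -> y \in s ->
    ('E_P[fun w : Omega => emb_dist (F w) s x y] <= (t * l2dist x y)%:E)%E.

(* The summand 1 is the usual reading of O(sqrt d * log Phi): a dominating
   embedding has distortion at least 1, whereas log Phi vanishes for equidistant
   points. *)
Definition distortion_bound (R : realType) (d : nat) (C Phi : R) : R :=
  C * (Num.sqrt d%:R * (1 + ln Phi)).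

(* Main.v *)
(* Fix a random partition of R^d into cells of diameter at most 1 that
   separates x and y with probability O(sqrt d |x - y|) and never separates
   two points of the ball of radius 1/4 around the origin. Rescaling it by
   2^i for every integer i, with the same randomness at all scales, and
   letting D(x, y) be twice the largest scale at which x and y are separated
   defines a dominating ultrametric on the whole of R^d: the partitions need
   not be nested, since each scale contributes an ultrametric. The algorithm
   maps x to x - x_1. All distances to the origin are then at most the
   diameter M of the input, so x and y can only be separated at scales below
   4M, while D >= |x - y|; hence O(1 + log (M / |x - y|)) scales are
   relevant, each contributing O(sqrt d |x - y|) to the expectation.

   The partition comes from correlated sampling. For b in {0,1}^d the weights
   F_b(x) = prod_i sin^2 (x_i + b_i pi/2) sum to 1, and F_b vanishes on the
   walls of a shifted grid of cubes of side pi. Going through all b, a fresh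
   uniform threshold h captures the points with F_b(x) > h, which are
   clustered according to their cube; points that are not captured go on to
   the next b. As the square roots of the weights have the product affinity
   prod_i cos (x_i - y_i), a round over all b separates x from y with
   probability only O(|x - y|), without any dependence on d, and the diameter
   of a cube is pi sqrt d. Each round leaves a point uncaptured with
   probability at most 1/2; after d rounds the weights are multiplied by 2^d,
   which captures everything. *)

Require Import Defs.
From HB Require Import structures.
From mathcomp Require Import all_boot all_order all_algebra.
From mathcomp Require Import all_classical all_reals all_analysis.
From mathcomp Require Import measurable_realfun.
From mathcomp Require Import ring lra zify.

Set Implicit Arguments.
Unset Strict Implicit.
Unset Printing Implicit Defensive.

Import Order.TTheory GRing.Theory Num.Theory.
Import numFieldNormedType.Exports.
Local Open Scope classical_set_scope.
Local Open Scope ring_scope.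

(** * Random partitions *)

(* [near] holds within every cell, and [core] forces two points into the same
   cell; both hold surely and not just almost surely. *)
Definition random_partition (R : realType) (X : Type)
    (near core : X -> X -> Prop) (q : X -> X -> R) : Prop :=
  exists (disp : measure_display) (Omega : measurableType disp)
         (P : probability Omega R) (K : Type) (N : Omega -> X -> K),
    forall x y : X,
      [/\ forall w, N w x = N w y -> near x y,
          forall w, core x y -> N w x = N w y,
          measurable [set w | N w x <> N w y] &
          (P [set w | N w x <> N w y] <= (q x y)%:E)%E].

(** The uniform variable is reset to 0 outside [[0, 1[], so that [u h < 1] holds surely: a point of
    weight 1 is then captured for every outcome. *)
Lemma uniform_threshold (R : realType) :
  exists (disp : measure_display) (T : measurableType disp)
         (U : probability T R) (u : T -> R),
    [/\ forall h, 0 <= u h < 1, forall a, measurable [set h | u h < a] &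
        forall a, 0 <= a <= 1 -> U [set h | u h < a] = a%:E].
Proof.
pose u (h : R) : R := if 0 <= h < 1 then h else 0.
have mu : measurable_fun [set: R] u.
  apply: measurable_fun_if => //=; apply: measurable_and => //.
  - exact: measurable_fun_ler.
  - exact: measurable_fun_ltr.
have uE a : [set h | u h < a] = u @^-1` `]-oo, a[%classic.
  by apply/seteqP; split => h /=; rewrite in_itv.
have mua a : measurable [set h | u h < a].
  by rewrite uE -[X in measurable X]setTI; exact: mu.
exists _, _, (uniform_prob (@ltr01 R)), u; split => //.
  move=> h; rewrite /u; case: ifPn => // _; by rewrite lexx ltr01.
move=> a /andP[a0 a1]; rewrite [LHS]integral_uniform_pdf.
rewrite (eq_integral (cst 1%:E)); last first.
  move=> x; rewrite inE /= => -[_]; rewrite in_itv/= /uniform_pdf => ->.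
  by rewrite subr0 invr1.
rewrite integral_cst ?mul1e; last first.
  by apply: measurableI; [exact: mua|exact: measurable_itv].
move: a0; rewrite le_eqVlt => /predU1P[<-|a0].
  rewrite (_ : _ `&` _ = set0) ?measure0//.
  apply/seteqP; split => // h /= [+ _]; rewrite /u; case: ifPn => [/andP[? _]|_].
    by lra.
  by rewrite ltxx.
(* The endpoint 1 is reset to 0 and so lies below [a]; it is a null set. *)
rewrite (_ : _ `&` _ = `[0, a[%classic `|` [set 1 : R]); last first.
  apply/seteqP; split => h /=; rewrite !in_itv/= /u; case: ifPn => h01.
  - by move=> [ha _]; left; rewrite ha; case/andP: h01 => ->.
  - move=> [_ /andP[h0 h1]]; right; move: h01; rewrite h0/= -leNgt => h1'.
    by apply/eqP; rewrite eq_le h1.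
  - by move: h01 => /andP[h0 h1] [/andP[_ ha]|?]; split => //; lra.
  - move=> [/andP[h0 ha]|->]; last by rewrite a0 ler01 lexx.
    by move: h01; rewrite h0/= -leNgt => h1'; lra.
rewrite measureU//.
- rewrite -[RHS]adde0; congr (_ + _)%E; last exact: lebesgue_measure_set1.
  by apply: (etrans (lebesgue_measure_itv _)); rewrite /= lte_fin a0 sube0.
- apply/seteqP; split => // h /= [+ h1]; rewrite h1 in_itv/= => /andP[_]; lra.
Qed.

(* The probability that a uniform threshold [h] separates [x] from [y], when the
   points with [h < F] are clustered according to [id]. *)
Definition separation (R : realType) (X K : Type) (F : X -> R) (id : X -> K)
    (x y : X) : R :=
  if `[< id x = id y >] then `|F x - F y| else Num.max (F x) (F y).

(** A fresh independent threshold decides the pair as soon as it is below the larger weight.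
    Otherwise both points fall through to the old partition, which happens with probability at most
    [1 - F x]. *)
Lemma random_partition_layer (R : realType) (X K : Type)
    (near core : X -> X -> Prop) (q : X -> X -> R) (F : X -> R) (id : X -> K) :
  (forall x, 0 <= F x <= 1) ->
  (forall x y, 0 < F x -> 0 < F y -> id x = id y -> near x y) ->
  random_partition near core q ->
  random_partition near (fun x y => [/\ F x = 1, F y = 1 & id x = id y])
    (fun x y => separation F id x y + (1 - F x) * q x y).
Proof.
move=> F01 idnear [disp [Om [P [K0 [N HN]]]]].
have [disp' [T [U [u [u01 mlt Uu]]]]] := uniform_threshold R.
pose N' (w : Om * T) (x : X) : K + K0 :=
  if u w.2 < F x then inl (id x) else inr (N w.1 x).
exists _, _, (P \x U)%E, _, N' => x y.
have [Nnear _ mcut Pcut] := HN x y.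
have q0 : 0 <= q x y by rewrite -lee_fin (le_trans _ Pcut).
set M := Num.max (F x) (F y); set m := Num.min (F x) (F y).
have /andP[Fx0 Fx1] := F01 x; have /andP[Fy0 Fy1] := F01 y.
have M01 : 0 <= M <= 1 by rewrite /M le_max Fx0/= ge_max Fx1.
have m01 : 0 <= m <= 1 by rewrite /m le_min Fx0 Fy0/= ge_min Fx1.
have mM : m <= M by rewrite /m /M ge_min !le_max !lexx.
pose C := [set w | N w x <> N w y].
(* [B] collects the thresholds at which this layer itself separates the pair. *)
pose B := [set h | u h < M] `\`
  (if `[< id x = id y >] then [set h | u h < m] else set0).
have mB : measurable B by apply: measurableD => //; case: ifP.
have mM' : measurable (~` [set h | u h < M]) by exact: measurableC.
have cutE : [set w | N' w x <> N' w y] =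
    (setT `*` B) `|` (C `*` ~` [set h | u h < M]).
  apply/seteqP; split => -[w h]; rewrite /N' /B /C /= /M /m.
  - rewrite lt_max; case: ifPn => hx; case: ifPn => hy.
    + case: asboolP => [idxy|nid _]; first by rewrite idxy.
      by left; split => //; split.
    + by move=> _; left; split => //; split => //; case: asboolP => _ /=;
        rewrite ?lt_min ?hx ?(negbTE hy).
    + by move=> _; left; split => //; split => //; case: asboolP => _ /=;
        rewrite ?lt_min ?(negbTE hx).
    + by move=> nN; right; split=> //= NN; apply: nN; rewrite NN.
  - rewrite lt_max; case: asboolP => idxy /=; rewrite ?lt_min;
      case: ifPn => hx; case: ifPn => hy //=.
    + by case=> [[_ []]|[_ []]].
    + by case=> [[_ []]|[nN _ []]].
    + by move=> _ [].
    + by case=> [[_ []]|[nN _ []]].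
have mcut' : measurable [set w | N' w x <> N' w y].
  by rewrite cutE; apply: measurableU; exact: measurableX.
split => //.
- move=> w; rewrite /N'; case: ifPn => hx; case: ifPn => hy //= -[]; last exact: Nnear.
  by apply: idnear; [move: hx|move: hy]; apply: le_lt_trans;
    case/andP: (u01 w.2).
- move=> w [Fx_1 Fy_1 idxy]; rewrite /N' Fx_1 Fy_1 idxy.
  by case/andP: (u01 w.2) => _ ->.
- rewrite cutE; apply: le_trans.
    by apply: measureU2; exact: measurableX.
  have XE (A : set Om) (D : set T) : measurable A -> measurable D ->
    (P \x U)%E (A `*` D) = (P A * U D)%E by exact: product_measure1E.
  rewrite EFinD; apply: leeD.
    rewrite [leLHS]XE// probability_setT mul1e /separation /B.
    case: asboolP => _; last by rewrite setD0 Uu.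
    rewrite measureD// ?setIidr.
    + rewrite [X in (X - _)%E](Uu _ M01) [X in (_ - X)%E](Uu _ m01).
      rewrite -EFinB lee_fin /M /m; case: (lerP (F x) (F y)) => _; exact: lexx.
    + by move=> h /= /lt_le_trans; apply.
    + by rewrite [ltLHS](Uu _ M01) ltry.
  rewrite [leLHS]XE// probability_setC// Uu// muleC.
  rewrite EFinM; apply: lee_pmul => //.
    by rewrite -EFinB lee_fin subr_ge0; case/andP: M01.
  by rewrite -EFinB lee_fin lerB// /M le_max lexx.
Qed.

Lemma random_partition_weaken (R : realType) (X : Type)
    (near near' core core' : X -> X -> Prop) (q q' : X -> X -> R) :
  (forall x y, near x y -> near' x y) -> (forall x y, core' x y -> core x y) ->
  (forall x y, q x y <= q' x y) ->
  random_partition near core q -> random_partition near' core' q'.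
Proof.
move=> nn' cc' qq' [disp [T [P [K [N HN]]]]].
exists disp, T, P, K, N => x y; have [Hn Hc mN PN] := HN x y; split => //.
- by move=> w /Hn/nn'.
- by move=> w /cc'; exact: Hc.
- by rewrite (le_trans PN)// lee_fin.
Qed.

Lemma separation_ge0 (R : realType) (X K : Type) (F : X -> R) (id : X -> K) x y :
  (forall x, 0 <= F x) -> 0 <= separation F id x y.
Proof.
by move=> F0; rewrite /separation; case: asboolP => _ //; rewrite le_max F0.
Qed.

Lemma random_partition_layers (R : realType) (X K I : Type)
    (near : X -> X -> Prop) (q : X -> X -> R)
    (bs : seq I) (F : I -> X -> R) (id : I -> X -> K) :
  (forall b x, 0 <= F b x <= 1) ->
  (forall b x y, id b x = id b y -> near x y) ->
  random_partition near (fun _ _ => False) q ->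
  random_partition near (fun _ _ => False)
    (fun x y => \sum_(b <- bs) separation (F b) (id b) x y
                + (\prod_(b <- bs) (1 - F b x)) * q x y).
Proof.
move=> F01 idnear Hq; elim: bs => [|b bs IH].
  apply: random_partition_weaken Hq => // x y.
  by rewrite !big_nil add0r mul1r.
have := random_partition_layer (F01 b) (fun x y _ _ => @idnear b x y) IH.
apply: random_partition_weaken => // x y.
(* The factor [1 - F b x] is dropped in front of the later separations but kept in front of [q],
   where the product is the probability that no layer captures [x]. *)
rewrite !big_cons mulrDr mulrA -!addrA lerD2l lerD2r ler_piMl//.
  by apply: sumr_ge0 => i _; apply: separation_ge0 => z; case/andP: (F01 i z).
by rewrite gerBl; case/andP: (F01 b x).
Qed.

(** * Sines and cubes *)

Lemma sin_le (R : realType) (x : R) : 0 <= x -> sin x <= x.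
Proof.
move=> x0; have [|c _] := @MVT_segment R sin cos 0 x x0
  (fun y _ => is_derive_sin y).
  exact/continuous_subspaceT/continuous_sin.
by rewrite sin0 !subr0 => ->; rewrite ler_piMl// cos_le1.
Qed.

(** By the half-angle formula this reduces to [|sin (x / 2)| <= |x / 2|]. *)
Lemma cos_ge (R : realType) (x : R) : 1 - x ^+ 2 / 2 <= cos x.
Proof.
wlog x0 : x / 0 <= x.
  move=> H; have [/H//|x0] := lerP 0 x.
  by rewrite -cosN -sqrrN; apply: H; rewrite oppr_ge0 ltW.
have -> : cos x = 1 - 2 * sin (x / 2) ^+ 2.
  rewrite {1}(splitr x) cosD -!expr2 cos2sin2; ring.
have s0 : -1 <= sin (x / 2) <= 1 by rewrite sin_geN1 sin_le1.
have s1 : sin (x / 2) <= x / 2 by apply: sin_le; rewrite divr_ge0.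
have s2 : - (x / 2) <= sin (x / 2).
  have [x2|x2] := lerP (x / 2) pi.
    by rewrite (le_trans _ (sin_ge0_pi _))// ?oppr_le0 ?divr_ge0//= x2 divr_ge0.
  by have := pi_ge2 R; case/andP: s0 => ? ? ?; lra.
suff : sin (x / 2) ^+ 2 <= (x / 2) ^+ 2 by lra.
by rewrite -[leLHS]real_normK ?num_real// lerXn2r ?nnegrE ?divr_ge0// ler_norml s2.
Qed.

Lemma sinM_shift (R : realType) (s t : R) (n : int) :
  sin (s + n%:~R * pi) * sin (t + n%:~R * pi) = sin s * sin t.
Proof.
have shiftn (k : nat) u v :
    sin (u + k%:R * pi) * sin (v + k%:R * pi) = sin u * sin v :> R.
  rewrite !mulr_natl !(alternatingn (@sinDpi R)) mulrACA -expr2 sqrr_sign.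
  by rewrite mul1r.
case: n => k; first exact: shiftn.
rewrite -(shiftn k.+1); congr (sin _ * sin _);
  by rewrite NegzE mulrNz mulNr -pmulrn subrK.
Qed.

Lemma floor_pi_split (R : realType) (t : R) :
  exists2 a : R, 0 <= a < pi & t = a + (Num.floor (t / pi))%:~R * pi.
Proof.
have := floor_itv (t / pi); rewrite ler_pdivlMr ?pi_gt0// ltr_pdivrMr ?pi_gt0//.
rewrite intrD mulrDl mul1r => /andP[h1 h2].
exists (t - (Num.floor (t / pi))%:~R * pi); last by rewrite subrK.
by apply/andP; split; lra.
Qed.

Lemma sin_same_floor (R : realType) (s t : R) :
  Num.floor (s / pi) = Num.floor (t / pi) ->
  `|s - t| <= pi /\ 0 <= sin s * sin t.
Proof.
have [a /andP[a0 api] sE] := floor_pi_split s.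
have [b /andP[b0 bpi] tE] := floor_pi_split t.
move=> e; rewrite e in sE; move: (Num.floor _) sE tE => n sE tE; rewrite sE tE; split.
  by rewrite ler_norml; apply/andP; split; lra.
by rewrite sinM_shift mulr_ge0// sin_ge0_pi// ?a0 ?b0 ltW.
Qed.

Lemma sin_diff_floor (R : realType) (s t : R) :
  Num.floor (s / pi) <> Num.floor (t / pi) -> `|s - t| <= pi ->
  sin s * sin t <= 0.
Proof.
wlog: s t / Num.floor (s / pi) < Num.floor (t / pi).
  move=> H ne st; have [lt|lt|e] := ltgtP (Num.floor (s / pi)) (Num.floor (t / pi)).
  - exact: H.
  - by rewrite mulrC; apply: H => //; [exact/nesym|rewrite distrC].
  - by [].
move=> lt _ st.
have [a /andP[a0 api] sE] := floor_pi_split s.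
have [b /andP[b0 bpi] tE] := floor_pi_split t.
have pi0 := pi_gt0 R.
(* Points at distance at most [pi] in different intervals lie in consecutive ones, where the sine
   has opposite signs. *)
have tn : Num.floor (t / pi) = Num.floor (s / pi) + 1.
  apply/eqP; rewrite eq_le lezD1 lt andbT -ltzD1.
  rewrite -(ltr_int R) -(ltr_pM2r pi0) !intrD !mulrDl !mul1r.
  by move: st; rewrite ler_norml => /andP[]; lra.
have {}tE : t = (b + pi) + (Num.floor (s / pi))%:~R * pi.
  by rewrite {1}tE tn intrD mulrDl mul1r; ring.
rewrite {1}sE tE sinM_shift sinDpi mulrN oppr_le0 mulr_ge0//.
  by rewrite sin_ge0_pi// a0 ltW.
by rewrite sin_ge0_pi// b0 ltW.
Qed.

(** This is the Weierstrass product inequality. The [a i] may exceed 1, so the cases with a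
    nonpositive factor on the left are treated first. *)
Lemma prod_ge1Bsum (R : realType) (I : Type) (s : seq I) (c a : I -> R) :
  (forall i, 0 <= a i) -> (forall i, 0 <= c i) -> (forall i, 1 - a i <= c i) ->
  1 - \sum_(i <- s) a i <= \prod_(i <- s) c i.
Proof.
move=> a0 c0 ac; elim: s => [|i s IH]; first by rewrite !big_nil subr0.
rewrite !big_cons; set S := \sum_(_ <- _) _ in IH *; set P := \prod_(_ <- _) _ in IH *.
have S0 : 0 <= S by exact: sumr_ge0.
have P0 : 0 <= P by exact: prodr_ge0.
have [h|h] := lerP (1 - S) 0.
  by apply: (@le_trans _ _ 0); [have := a0 i; lra|exact: mulr_ge0].
have [h'|h'] := lerP (1 - a i) 0.
  by apply: (@le_trans _ _ 0); [lra|exact: mulr_ge0].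
apply: (@le_trans _ _ ((1 - a i) * (1 - S))).
  by have := mulr_ge0 (a0 i) S0; lra.
by apply: ler_pM => //; exact: ltW.
Qed.

(** The induction rests on [(1 - a) (1 + a + S) <= 1 + S]. For [a i] with sum 1 the bound is one
    half. *)
Lemma prod1B_le (R : realType) (I : Type) (s : seq I) (a : I -> R) :
  (forall i, 0 <= a i <= 1) ->
  \prod_(i <- s) (1 - a i) <= (1 + \sum_(i <- s) a i)^-1.
Proof.
move=> a01; elim: s => [|i s IH]; first by rewrite !big_nil addr0 invr1.
rewrite !big_cons; set S := \sum_(_ <- _) _ in IH *.
have S0 : 0 <= S by apply: sumr_ge0 => j _; case/andP: (a01 j).
have /andP[a0 a1] := a01 i.
apply: (@le_trans _ _ ((1 - a i) * (1 + S)^-1)).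
  by rewrite ler_wpM2l// subr_ge0.
rewrite ler_pdivrMr ?ltr_wpDr// mulrC ler_pdivlMr; last by rewrite ltr_wpDr ?addr_ge0.
by have := mulr_ge0 a0 S0; have := mulr_ge0 a0 a0; lra.
Qed.

(** Truncation at 1 is 1-Lipschitz and does not increase its argument. *)
Lemma separation_min1 (R : realType) (X K : Type) (lam : R) (F : X -> R)
    (id : X -> K) (x y : X) :
  0 <= lam ->
  separation (fun z => Num.min 1 (lam * F z)) id x y
  <= lam * separation F id x y.
Proof.
move=> lam0; rewrite /separation; case: asboolP => _.
  rewrite -[lam in leRHS]ger0_norm// -normrM mulrBr.
  move: (lam * F x) (lam * F y) => u v.
  have uv := ler_norm (u - v); have := ler_norm (v - u); rewrite distrC => vu.
  rewrite ler_norml !minEle; case: ifPn; rewrite -?ltNge => ?;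
    by case: ifPn; rewrite -?ltNge => ?; apply/andP; split; lra.
by rewrite maxr_pMr// ge_max !le_max !ge_min !lexx !orbT.
Qed.

(** The half-period shift turns sine into cosine, so the squared sines for the two values of [b] add
    up to 1. *)
Definition shifted (R : realType) (b : bool) (t : R) : R := t + b%:R * (pi / 2).

Definition cube_weight (R : realType) (d : nat) (b : {ffun 'I_d -> bool})
    (x : 'rV[R]_d) : R :=
  (\prod_i sin (shifted (b i) (x ord0 i))) ^+ 2.

Definition cube_cell (R : realType) (d : nat) (b : {ffun 'I_d -> bool})
    (x : 'rV[R]_d) : {ffun 'I_d -> int} :=
  [ffun i => Num.floor (shifted (b i) (x ord0 i) / pi)].

Lemma sin_shifted (R : realType) (t : R) :
  (sin (shifted true t) = cos t) * (sin (shifted false t) = sin t).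
Proof. by rewrite /shifted mul1r sinDpihalf mul0r addr0. Qed.

Lemma sum_cube_weight (R : realType) (d : nat) (x : 'rV[R]_d) :
  \sum_b cube_weight b x = 1.
Proof.
under eq_bigr do rewrite /cube_weight -prodrXl.
rewrite -(bigA_distr_bigA (fun i c => sin (shifted c (x ord0 i)) ^+ 2)).
by rewrite big1// => i _; rewrite big_bool /= !sin_shifted cos2Dsin2.
Qed.

Lemma cube_weight_ge0 (R : realType) (d : nat) b (x : 'rV[R]_d) :
  0 <= cube_weight b x.
Proof. exact: sqr_ge0. Qed.

Lemma cube_weight_itv (R : realType) (d : nat) b (x : 'rV[R]_d) :
  0 <= cube_weight b x <= 1.
Proof.
rewrite cube_weight_ge0/= -(sum_cube_weight x) (bigD1 b)//= lerDl.
by apply: sumr_ge0 => c _; exact: cube_weight_ge0.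
Qed.

Lemma l2distE (R : realType) (d : nat) (x y : 'rV[R]_d) :
  l2dist x y ^+ 2 = \sum_i (x ord0 i - y ord0 i) ^+ 2.
Proof. by rewrite sqr_sqrtr// sumr_ge0// => i _; exact: sqr_ge0. Qed.

Lemma l2dist_ge0 (R : realType) (d : nat) (x y : 'rV[R]_d) : 0 <= l2dist x y.
Proof. exact: sqrtr_ge0. Qed.

Lemma coord_le_l2dist (R : realType) (d : nat) (x y : 'rV[R]_d) i :
  `|x ord0 i - y ord0 i| <= l2dist x y.
Proof.
rewrite -(@ler_pXn2r _ 2)// ?nnegrE ?l2dist_ge0// l2distE real_normK ?num_real//.
by rewrite (bigD1 i)//= lerDl sumr_ge0// => j _; exact: sqr_ge0.
Qed.

Lemma l2dist_eq0 (R : realType) (d : nat) (x y : 'rV[R]_d) :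
  (l2dist x y == 0) = (x == y).
Proof.
apply/eqP/eqP => [xy|->].
  apply/rowP => i; apply/eqP; rewrite -subr_eq0 -normr_le0 -xy.
  exact: coord_le_l2dist.
by apply/eqP; rewrite -sqrf_eq0 l2distE big1// => i _; rewrite subrr expr0n.
Qed.

Lemma cube_cell_near (R : realType) (d : nat) b (x y : 'rV[R]_d) :
  cube_cell b x = cube_cell b y -> l2dist x y <= pi * Num.sqrt d%:R.
Proof.
move=> e; have pi0 := pi_ge0 R.
rewrite -(@ler_pXn2r _ 2)// ?nnegrE ?l2dist_ge0 ?mulr_ge0 ?sqrtr_ge0// l2distE.
rewrite exprMn sqr_sqrtr ?ler0n// mulr_natr.
rewrite -[d in leRHS]card_ord -sumr_const; apply: ler_sum => i _.
move/ffunP/(_ i): e; rewrite !ffunE => /sin_same_floor[+ _].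
rewrite /shifted (_ : _ - _ = x ord0 i - y ord0 i); last by ring.
by move=> h; rewrite -[leLHS]real_normK ?num_real// lerXn2r.
Qed.

(* Cauchy-Schwarz in AM-GM form: on a common cell the weights are squares
   [X ^+ 2] and [Y ^+ 2] with [X Y] the product below, whereas across different
   cells some factor of this product vanishes. *)
Lemma separation_cube_le (R : realType) (d : nat) b (x y : 'rV[R]_d) (t : R) :
  0 < t -> (forall i, `|x ord0 i - y ord0 i| <= pi) ->
  separation (cube_weight b) (cube_cell b) x y <=
  (cube_weight b x + cube_weight b y
   - 2 * \prod_i Num.max 0 (sin (shifted (b i) (x ord0 i)) *
                            sin (shifted (b i) (y ord0 i)))) / (2 * t)
  + t * (cube_weight b x + cube_weight b y).
Proof.
move=> t0 xy; have t2 : 0 < 2 * t by rewrite mulr_gt0.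
set A := \prod_i Num.max _ _.
rewrite /separation; case: asboolP => [e|ne].
  rewrite /cube_weight; set X := \prod_i _; set Y := \prod_i _.
  have -> : A = X * Y.
    rewrite /A /X /Y -big_split; apply: eq_bigr => i _ /=.
    by move/ffunP/(_ i): e; rewrite !ffunE => /sin_same_floor[_ /max_idPr].
  have h1 := sqr_ge0 ((X - Y) - t * (X + Y)).
  have h2 := sqr_ge0 ((X - Y) + t * (X + Y)).
  have h3 := sqr_ge0 (t * (X - Y)).
  (* [h1] and [h2] bound [2 t |X ^+ 2 - Y ^+ 2|] by [(X - Y) ^+ 2 + t ^+ 2 (X + Y) ^+ 2], and [h3]
     replaces [(X + Y) ^+ 2] by [2 (X ^+ 2 + Y ^+ 2)]. *)
  rewrite ler_norml lerNl; apply/andP; split;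
    by rewrite -(ler_pM2r t2) [leRHS]mulrDl divfK ?gt_eqF//; lra.
have -> : A = 0.
  suff [i ii] : exists i, Num.floor (shifted (b i) (x ord0 i) / pi) <>
                          Num.floor (shifted (b i) (y ord0 i) / pi).
    rewrite /A (bigD1 i)//= (_ : Num.max _ _ = 0) ?mul0r//; apply/max_idPl.
    apply: sin_diff_floor => //; rewrite /shifted.
    by rewrite (_ : _ - _ = x ord0 i - y ord0 i) ?xy//; ring.
  apply: contrapT => /forallNP h; apply: ne; apply/ffunP => i; rewrite !ffunE.
  exact: contrapT (h i).
rewrite mulr0 subr0.
have := cube_weight_ge0 b x; have := cube_weight_ge0 b y.
move: (cube_weight b x) (cube_weight b y) => u v v0 u0.
rewrite -(ler_pM2r t2) [leRHS]mulrDl divfK ?gt_eqF//.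
apply: (@le_trans _ _ ((u + v) * (2 * t))).
  by rewrite ler_pM2r// ge_max; apply/andP; split; lra.
have h : 0 <= (u + v) * (1 - 2 * t + 2 * t ^+ 2).
  apply: mulr_ge0; first exact: addr_ge0.
  by have := sqr_ge0 (1 - 2 * t); have := sqr_ge0 t; lra.
by lra.
Qed.

(** The weights at each point sum to 1 and the products sum to an affinity [A >= 1 - D ^+ 2 / 2].
    With [t = D / 2] the bounds for single [b] add up to [(2 - 2 A) / D + D <= 2 D]. If some
    coordinates differ by more than [pi], the trivial bound 2 suffices. *)
Lemma sum_separation_cube (R : realType) (d : nat) (x y : 'rV[R]_d) :
  \sum_b separation (cube_weight b) (cube_cell b) x y <= 2 * l2dist x y.
Proof.
have [->|xy] := eqVneq x y.
  rewrite big1 ?mulr_ge0 ?l2dist_ge0// => b _; rewrite /separation subrr normr0.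
  by case: asboolP.
have D0 : 0 < l2dist x y by rewrite lt_def l2dist_eq0 xy l2dist_ge0.
case: (pselect (forall i, `|x ord0 i - y ord0 i| <= pi)) => [small|]; last first.
  move=> /existsNP[i /negP]; rewrite -ltNge => big.
  apply: (@le_trans _ _ (\sum_b (cube_weight b x + cube_weight b y))).
    apply: ler_sum => b _; rewrite /separation.
    have := cube_weight_ge0 b x; have := cube_weight_ge0 b y => v0 u0.
    case: asboolP => _; last by rewrite ge_max; apply/andP; split; lra.
    by rewrite ler_norml; apply/andP; split; lra.
  rewrite big_split/= !sum_cube_weight.
  by have := coord_le_l2dist x y i; have := pi_ge2 R; lra.
set D := l2dist x y in D0 *.
have t0 : 0 < D / 2 by rewrite divr_gt0.
apply: le_trans.
  by apply: ler_sum => b _; exact: separation_cube_le t0 small.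
rewrite big_split/= -mulr_suml -mulr_sumr sumrB big_split/= -mulr_sumr.
rewrite !sum_cube_weight.
rewrite -(bigA_distr_bigA (fun i c => Num.max 0 (sin (shifted c (x ord0 i)) *
                                    sin (shifted c (y ord0 i))))).
set A := \prod_i _.
have hA : 1 - D ^+ 2 / 2 <= A.
  rewrite l2distE mulr_suml; apply: prod_ge1Bsum => i.
  - by rewrite mulr_ge0 ?sqr_ge0// invr_ge0.
  - by apply: sumr_ge0 => c _; rewrite le_max lexx.
  (* The two shifts contribute at least [cos s cos t + sin s sin t = cos (s - t)]. *)
  - rewrite (le_trans (cos_ge _))// cosB big_bool/= !sin_shifted.
    by apply: lerD; rewrite le_max lexx orbT.
rewrite (_ : 2 * (D / 2) = D); last by field.
rewrite (_ : 2 * D = D + D / 2 * (1 + 1)); last by field.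
by rewrite lerD2r ler_pdivrMr//; lra.
Qed.

Lemma l2distC (R : realType) (d : nat) (x y : 'rV[R]_d) : l2dist x y = l2dist y x.
Proof. by congr Num.sqrt; apply: eq_bigr => i _; rewrite -sqrrN opprB. Qed.

(** Summing [(a + b) ^+ 2 <= a ^+ 2 (1 + T / S) + b ^+ 2 (1 + S / T)] over the coordinates gives
    [(S + T) ^+ 2]. *)
Lemma l2dist_triangle (R : realType) (d : nat) (x y z : 'rV[R]_d) :
  l2dist x z <= l2dist x y + l2dist y z.
Proof.
have [->|xy] := eqVneq x y; first by rewrite lerDr l2dist_ge0.
have [->|yz] := eqVneq y z; first by rewrite lerDl l2dist_ge0.
have S0 : 0 < l2dist x y by rewrite lt_def l2dist_eq0 xy l2dist_ge0.
have T0 : 0 < l2dist y z by rewrite lt_def l2dist_eq0 yz l2dist_ge0.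
rewrite -(@ler_pXn2r _ 2)// ?nnegrE ?addr_ge0 ?l2dist_ge0// l2distE.
have := l2distE x y; have := l2distE y z.
move: (l2dist x y) (l2dist y z) S0 T0 => S T S0 T0 TE SE.
apply: (@le_trans _ _ (S ^+ 2 * (1 + T / S) + T ^+ 2 * (1 + S / T))); last first.
  have -> : S ^+ 2 * (1 + T / S) = S ^+ 2 + S * T by field; rewrite gt_eqF.
  have -> : T ^+ 2 * (1 + S / T) = T ^+ 2 + S * T by field; rewrite gt_eqF.
  by lra.
rewrite SE TE !mulr_suml -big_split/=; apply: ler_sum => i _.
have -> : x ord0 i - z ord0 i = (x ord0 i - y ord0 i) + (y ord0 i - z ord0 i) by ring.
move: (_ - y ord0 i) (y ord0 i - _) => a b.
have := mulr_ge0 (ltW (divr_gt0 T0 S0)) (sqr_ge0 (a - b * S / T)).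
have -> : T / S * (a - b * S / T) ^+ 2 = a ^+ 2 * (T / S) + b ^+ 2 * (S / T) - 2 * (a * b).
  by field; rewrite !gt_eqF.
by lra.
Qed.

Lemma l2distZ (R : realType) (d : nat) (c : R) (x y : 'rV[R]_d) :
  0 <= c -> l2dist (c *: x) (c *: y) = c * l2dist x y.
Proof.
move=> c0; rewrite /l2dist -{3}(ger0_norm c0) -sqrtr_sqr -sqrtrM ?sqr_ge0//.
congr Num.sqrt; rewrite mulr_sumr; apply: eq_bigr => i _.
by rewrite !mxE -mulrBr exprMn.
Qed.

Lemma l2dist_dim0 (R : realType) (x y : 'rV[R]_0) : l2dist x y = 0.
Proof. by apply/eqP; rewrite l2dist_eq0; apply/eqP/rowP => -[]. Qed.

Lemma l2dist_le_sqrt (R : realType) (d : nat) (x y : 'rV[R]_d) :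
  l2dist x y <= Num.sqrt d%:R * l2dist x y.
Proof.
case: d x y => [|d] x y; first by rewrite l2dist_dim0 mulr0.
by rewrite ler_peMl ?l2dist_ge0// -[leLHS]sqrtr1 ler_wsqrtr// ler1n.
Qed.

(** * Random partitions of Euclidean space *)

Lemma random_partition_comp (R : realType) (X Y : Type)
    (near core : X -> X -> Prop) (q : X -> X -> R) (g : Y -> X) :
  random_partition near core q ->
  random_partition (fun x y => near (g x) (g y)) (fun x y => core (g x) (g y))
    (fun x y => q (g x) (g y)).
Proof.
move=> [disp [T [P [K [N HN]]]]]; exists disp, T, P, K, (fun w y => N w (g y)).
by move=> x y; exact: HN.
Qed.

(** The deterministic start of the construction: its cells satisfy any reflexive [near], at the
    trivial cost 1. *)
Lemma random_partition_singletons (R : realType) (X : Type) :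
  random_partition (fun x y : X => x = y) (fun _ _ => False) (fun _ _ => 1 : R).
Proof.
have [disp [T [U _]]] := uniform_threshold R.
exists disp, T, U, X, (fun _ x => x) => x y.
have mxy : measurable [set w : T | x <> y].
  have [e|ne] := pselect (x = y).
    by rewrite (_ : mkset _ = set0)//; apply/seteqP; split => // w /=.
  by rewrite (_ : mkset _ = setT)//; apply/seteqP; split => // w /=.
by split => //; exact: probability_le1.
Qed.

(** One round over all grid shifts; the product is the probability that it leaves [x] uncaptured. *)
Lemma random_partition_sweep (R : realType) (d : nat) (lam : R)
    (q : 'rV[R]_d -> 'rV[R]_d -> R) :
  0 <= lam ->
  random_partition (fun x y => l2dist x y <= pi * Num.sqrt d%:R)
    (fun _ _ => False) q ->
  random_partition (fun x y => l2dist x y <= pi * Num.sqrt d%:R)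
    (fun _ _ => False)
    (fun x y => lam * (2 * l2dist x y) +
                (\prod_b (1 - Num.min 1 (lam * cube_weight b x))) * q x y).
Proof.
move=> lam0 Hq.
have F01 b (x : 'rV[R]_d) : 0 <= Num.min 1 (lam * cube_weight b x) <= 1.
  by rewrite le_min ler01 ge_min lexx/= mulr_ge0// cube_weight_ge0.
have := random_partition_layers (index_enum {ffun 'I_d -> bool}) F01
  (@cube_cell_near R d) Hq.
apply: random_partition_weaken => // x y; rewrite lerD2r.
apply: (@le_trans _ _ (\sum_b lam * separation (cube_weight b) (cube_cell b) x y)).
  by apply: ler_sum => b _; exact: separation_min1.
by rewrite -mulr_sumr ler_wpM2l// sum_separation_cube.
Qed.

(** Averaging: the [2 ^+ d] weights sum to 1. *)
Lemma exists_heavy_cube (R : realType) (d : nat) (x : 'rV[R]_d) :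
  exists b, 1 <= 2 ^+ d * cube_weight b x.
Proof.
apply: contrapT => /forallNP small.
have : \sum_b 2 ^+ d * cube_weight b x < \sum_(b : {ffun 'I_d -> bool}) 1.
  apply: ltr_sum.
    by apply/hasP; exists [ffun=> true] => //; rewrite mem_index_enum.
  by move=> b _; rewrite ltNge; exact/negP/small.
rewrite -mulr_sumr sum_cube_weight mulr1 sumr_const card_ffun card_bool card_ord.
by rewrite natrX ltxx.
Qed.

(** The base case is the final round with [lam = 2 ^+ d], which captures everything. Each round put
    before it costs [2 |x - y|] and leaves a point uncaptured with probability at most 1/2, so the
    coefficient evolves as [c' = 2 + c / 2]: the fixed point is 4 and the excess halves. *)
Lemma random_partition_cubes (R : realType) (d n : nat) :
  random_partition (fun x y : 'rV[R]_d => l2dist x y <= pi * Num.sqrt d%:R)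
    (fun _ _ => False)
    (fun x y => (4 + 2 * 2 ^+ d / 2 ^+ n) * l2dist x y).
Proof.
elim: n => [|n IH].
  have pd0 : 0 <= pi * Num.sqrt d%:R :> R by rewrite mulr_ge0 ?pi_ge0 ?sqrtr_ge0.
  have := random_partition_singletons R 'rV[R]_d.
  move=> /(@random_partition_weaken _ _ _
    (fun x y : 'rV[R]_d => l2dist x y <= pi * Num.sqrt d%:R) _ _ _ _ _
      (fun _ _ => id) (fun _ _ => lexx _)) H.
  have /H{H} : forall x y : 'rV[R]_d, x = y -> l2dist x y <= pi * Num.sqrt d%:R.
    by move=> x _ <-; rewrite (eqP (_ : l2dist x x == 0))// l2dist_eq0.
  move=> /(random_partition_sweep (exprn_ge0 d (ler0n R 2))).
  apply: random_partition_weaken => // x y.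
  have [b hb] := exists_heavy_cube x.
  rewrite [X in X * 1](_ : _ = 0).
    rewrite expr0 divr1 mul0r addr0 mulrA (mulrC _ 2) ler_wpM2r ?l2dist_ge0//.
    by rewrite lerDr.
  by rewrite (bigD1 b)//= (min_idPl hb) subrr mul0r.
have := random_partition_sweep (@ler01 R) IH.
apply: random_partition_weaken => // x y.
have -> : \prod_b (1 - Num.min 1 (1 * cube_weight b x)) =
          \prod_b (1 - cube_weight b x).
  apply: eq_bigr => b _; rewrite mul1r (min_idPr _)//.
  by case/andP: (cube_weight_itv b x).
have := prod1B_le (index_enum {ffun 'I_d -> bool}) (fun b => cube_weight_itv b x).
rewrite sum_cube_weight (_ : 1 + 1 = 2 :> R)// => half.
have c0 : 0 <= 2 * 2 ^+ d / 2 ^+ n :> R by rewrite !mulr_ge0 ?invr_ge0 ?exprn_ge0.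
apply: (@le_trans _ _ (1 * (2 * l2dist x y) +
   2^-1 * ((4 + 2 * 2 ^+ d / 2 ^+ n) * l2dist x y))).
  by rewrite lerD2l ler_wpM2r// mulr_ge0 ?l2dist_ge0// addr_ge0.
rewrite exprS invfM (mulrCA (2 * 2 ^+ d)).
by move: (2 * 2 ^+ d / 2 ^+ n) (l2dist x y) => u v; lra.
Qed.

Lemma random_partition_unit (R : realType) (d : nat) :
  random_partition (fun x y : 'rV[R]_d => l2dist x y <= 1)
    (fun x y => l2dist x 0 <= 4^-1 /\ l2dist y 0 <= 4^-1)
    (fun x y => (6 * pi + 4) * Num.sqrt d%:R * l2dist x y).
Proof.
have c0 : 0 <= pi * Num.sqrt d%:R :> R by rewrite mulr_ge0 ?pi_ge0 ?sqrtr_ge0.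
have := random_partition_comp (fun x : 'rV[R]_d => (pi * Num.sqrt d%:R) *: x)
  (random_partition_cubes R d d).
have nn (x y : 'rV[R]_d) : l2dist ((pi * Num.sqrt d%:R) *: x) ((pi * Num.sqrt d%:R) *: y)
    <= pi * Num.sqrt d%:R -> l2dist x y <= 1.
  (* For [d = 0] the scaling factor is 0, but all points coincide. *)
  case: d c0 x y => [|d] c0 x y; first by rewrite (l2dist_dim0 x y).
  rewrite l2distZ// -{2}[pi * _]mulr1 ler_pM2l// mulr_gt0 ?pi_gt0//.
move=> /(random_partition_weaken nn (fun x y => id) (fun x y => lexx _)) H.
(* This weight is 4-Lipschitz, equals 1 on the ball of radius 1/4 and vanishes outside radius 1/2,
   so that captured points are within distance 1 of each other. *)
pose F (x : 'rV[R]_d) : R := Num.min 1 (Num.max 0 (2 - 4 * l2dist x 0)).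
have F01 x : 0 <= F x <= 1 by rewrite /F le_min ler01 le_max lexx ge_min lexx.
have Fpos x : 0 < F x -> l2dist x 0 <= 2^-1.
  by rewrite /F lt_min lt_max ltxx /= => /andP[_ ?]; lra.
have idnear (x y : 'rV[R]_d) : 0 < F x -> 0 < F y -> tt = tt -> l2dist x y <= 1.
  move=> /Fpos Fx /Fpos Fy _; rewrite (le_trans (l2dist_triangle x 0 y))//.
  by rewrite (l2distC 0); lra.
have := random_partition_layer (id := fun=> tt) F01 idnear H.
apply: random_partition_weaken => // x y.
  have F1 z : l2dist z 0 <= 4^-1 -> F z = 1.
    by move=> z4; rewrite /F (max_idPr _) ?(min_idPl _)//; lra.
  by move=> [/F1 -> /F1 ->].
have FxFy : separation F (fun=> tt) x y <= 4 * l2dist x y.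
  rewrite /separation; case: asboolP => // _.
  have := l2dist_triangle x y 0; have := l2dist_triangle y x 0.
  rewrite (l2distC y x) /F; move: (l2dist x y) (l2dist x 0) (l2dist y 0) => s u v ? ?.
  rewrite ler_norml; case: (lerP 0 (2 - 4 * u)) => ?;
    case: (lerP 0 (2 - 4 * v)) => ?; rewrite !minEle;
    by do ?(case: ifPn; rewrite -?ltNge => ?); apply/andP; split; lra.
(* The 4 is the Lipschitz constant of [F]; the 6 is the coefficient [4 + 2] after [n = d] rounds. *)
have -> : (6 * pi + 4) * Num.sqrt d%:R * l2dist x y =
    4 * (Num.sqrt d%:R * l2dist x y) + 6 * (pi * Num.sqrt d%:R * l2dist x y) :> R.
  by ring.
apply: lerD; first by rewrite (le_trans FxFy)// ler_wpM2l// l2dist_le_sqrt.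
rewrite l2distZ// mulfK ?expf_neq0 ?pnatr_eq0// (_ : 4 + 2 = 6) -?natrD//.
have /andP[Fx0 Fx1] := F01 x.
by rewrite ler_piMl ?gerBl// mulr_ge0// mulr_ge0// l2dist_ge0.
Qed.

(** * Finite ultrametric spaces with geometric distances are 2-HSTs *)

(** The nodes are the closed balls of radius [r n], one level for each [n <= K]: in an ultrametric
    the balls of a given radius partition the space, and those of a larger radius are unions of
    them. *)
Lemma finite_ultrametric_2HST (R : realType) (Y : metricType R) (t : seq Y)
    (r : nat -> R) (K : nat) :
  is_ultrametric Y -> t != [::] -> r 0%N = 0 ->
  (forall n, 0 <= r n) -> (forall n, 2 * r n <= r n.+1) ->
  (forall x y, x \in t -> y \in t -> exists2 n, (n <= K)%N & mdist x y = r n) ->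
  is_2HST [set` t].
Proof.
move=> um; case: t => // a t _ r0 rge0 rdbl dist_r; set s := a :: t in dist_r *.
have rS n : r n <= r n.+1 by have := rge0 n; have := rdbl n; lra.
have rmono m n : (m <= n)%N -> r m <= r n.
  by move=> /subnK <-; elim: (n - m)%N => // j IH; exact: le_trans IH (rS _).
pose I := seq_sub s.
pose dI (x y : I) : R := mdist (val x) (val y).
have dIC x y : dI x y = dI y x by exact: metric_sym.
have dIK x y : dI x y <= r K.
  by rewrite /dI; have [n nK ->] := dist_r _ _ (valP x) (valP y); exact: rmono.
have dIum x y z e : dI x y <= e -> dI y z <= e -> dI x z <= e.
  by move=> xy yz; rewrite (le_trans (um _ (val y) _))// ge_max xy.
pose rep n (x : I) : I := odflt x [pick y | dI y x <= r n].
have repd n x : dI (rep n x) x <= r n.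
  by rewrite /rep; case: pickP => [y|_] //=; rewrite /dI mdistxx.
have repP n x y : (rep n x == rep n y) = (dI x y <= r n).
  apply/eqP/idP => [e|xy].
    by apply: dIum (repd n y); rewrite dIC -e; exact: repd.
  have E : (fun z => dI z x <= r n) =1 (fun z => dI z y <= r n).
    move=> z; apply/idP/idP => h; first exact: dIum h xy.
    by apply: dIum h _; rewrite dIC.
  rewrite /rep -(eq_pick E); case: pickP => //= /(_ x).
  by rewrite /dI mdistxx rge0.
have rep_rep m n x : (m <= n)%N -> rep n (rep m x) = rep n x.
  by move=> mn; apply/eqP; rewrite repP (le_trans (repd m x))// rmono.
pose T := {p : 'I_K.+1 * I | rep p.1 p.2 == p.2}.
(* Levels are capped at [K], which makes the root its own parent. *)
have mkP n x : let p := (inord (minn n K), rep (minn n K) x) : 'I_K.+1 * I in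
    rep p.1 p.2 == p.2.
  by rewrite /= inordK ?ltnS ?geq_minr// rep_rep.
pose mk n x : T :=
  exist (fun p : 'I_K.+1 * I => rep p.1 p.2 == p.2) _ (mkP n x).
have mk_lvl n x : (val (mk n x)).1 = minn n K :> nat.
  by rewrite /= inordK// ltnS geq_minr.
have mk_eq m n x y : minn m K = minn n K ->
    (mk m x == mk n y) = (dI x y <= r (minn m K)).
  move=> e; rewrite -val_eqE /= -pair_eqE /= -e eqxx /=; exact: repP.
have mk_surj (p : T) : p = mk (val p).1 (val p).2.
  case: p => -[i x] /= e; apply: val_inj => /=.
  have -> : minn i K = i by apply/minn_idPl; rewrite -ltnS.
  by rewrite inord_val (eqP e).
pose par (p : T) : T := mk (val p).1.+1 (val p).2.
have par_mk n x : par (mk n x) = mk n.+1 x.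
  apply/eqP; rewrite /par mk_eq mk_lvl.
    by rewrite (le_trans (repd _ _))// rmono// leq_min leqnSn geq_minr.
  by lia.
have iter_par j n x : iter j par (mk n x) = mk (n + j)%N x.
  by elim: j => [|j IH]; rewrite ?addn0//= IH par_mk addnS.
pose x0 : I := SeqSub (mem_head a t).
pose rt : T := mk K x0.
have mkK n x : (K <= n)%N -> mk n x = rt.
  move=> Kn; apply/eqP; rewrite mk_eq ?minnn ?(minn_idPr Kn)//; exact: dIK.
have par_rt : par rt = rt by rewrite par_mk mkK.
have conn n j x : (n <= j)%N -> fconnect par (mk n x) (mk j x).
  by move=> /subnKC <-; rewrite -iter_par; exact: fconnect_iter.
have rt_reach (v : T) : fconnect par v rt.
  by rewrite (mk_surj v) -(mkK ((val v).1 + K)%N (val v).2) ?leq_addl// conn ?leq_addr.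
pose TT := RootedTree par_rt rt_reach.
pose Gamma (v : TT) : R := r (val (v : T)).1.
have lvl_root (u : TT) : u != troot TT -> ((val (u : T)).1 < K)%N.
  apply: contraNT; rewrite -leqNgt => Ku; apply/eqP.
  by rewrite [LHS]mk_surj; exact: mkK.
have leafE (v : TT) : is_leaf v = ((val (v : T)).1 == 0%N :> nat).
  apply/idP/idP.
    apply: contraNT; rewrite -lt0n => v0; apply/existsP.
    have vK : ((val (v : T)).1 <= K)%N by rewrite -ltnS.
    exists (mk (val (v : T)).1.-1 (val (v : T)).2 : TT); apply/andP; split.
      apply: contraTneq v0 => /(congr1 (fun p : T => nat_of_ord (val p).1)).
      by rewrite !mk_lvl minnn; lia.
    by rewrite /= par_mk prednK// -mk_surj.
  move=> /eqP v0; apply/negP => /existsP[u /andP[/lvl_root uK /eqP uv]].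
  move: v0; rewrite -uv mk_lvl; lia.
pose toI (y : Y) : I := odflt x0 (insub y).
have toIK y : y \in s -> val (toI y) = y.
  by move=> ys; rewrite /toI (insubT (fun y => y \in s) ys).
have rep0 x y : dI x y <= r 0%N -> x = y.
  rewrite r0 => h; apply: val_inj; apply: mdist_positivity; apply/eqP.
  by rewrite eq_le h mdist_ge0.
exists TT, Gamma, (fun y => mk 0%N (toI y)); split.
- by move=> v; exact: rge0.
- by move=> v; rewrite leafE /Gamma => /eqP ->.
- move=> v u /andP[/lvl_root uK /eqP <-]; rewrite /Gamma mk_lvl.
  by rewrite (minn_idPl uK).
- split.
  + by move=> y /= ys; rewrite leafE mk_lvl min0n.
  + move=> x y; rewrite !inE => xs ys /eqP; rewrite mk_eq// min0n => /rep0 e.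
    by rewrite -(toIK _ xs) -(toIK _ ys) e.
  + move=> v /=; rewrite leafE => /eqP v0; exists (val (val (v : T)).2).
      exact: valP.
    rewrite [RHS]mk_surj v0; congr mk; apply: val_inj; rewrite toIK//; exact: valP.
- move=> x y /= xs ys.
  have [n0 n0K xyn0] := dist_r _ _ xs ys.
  have ex : exists n, (n <= K)%N && (mdist x y == r n).
    by exists n0; rewrite n0K xyn0/=.
  (* The least such [n] is the level where the balls around [x] and [y] first coincide: a lower
     level whose radius reaches the distance would have it as radius. *)
  case: (ex_minnP ex) => n /andP[nK /eqP xyn] nmin.
  have dxy : dI (toI x) (toI y) = r n by rewrite /dI !toIK.
  exists (mk n (toI x)); last by rewrite /Gamma mk_lvl (minn_idPl nK).
  split; first exact: conn.
    have -> : mk n (toI x) = mk n (toI y).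
      by apply/eqP; rewrite mk_eq// (minn_idPl nK) dxy.
    exact: conn.
  move=> z /iter_findex zi /iter_findex zj; move: zi zj.
  move: (findex _ _ _) (findex _ _ _) => j i; rewrite !iter_par !add0n => zi zj.
  have eK : minn i K = minn j K by rewrite -(mk_lvl i (toI x)) -(mk_lvl j (toI y)) zi zj.
  have := mk_eq i j (toI x) (toI y) eK; rewrite zi zj eqxx dxy -zi => /esym nle.
  have ni : (n <= minn i K)%N.
    rewrite leqNgt; apply/negP => lt.
    have e : mdist x y = r (minn i K).
      by apply/eqP; rewrite xyn eq_le nle/= rmono// ltnW.
    by have := nmin (minn i K); rewrite geq_minr e eqxx leqNgt lt => /(_ isT).
  by apply: conn; rewrite (leq_trans ni)// geq_minl.
Qed.

(** * The ultrametric of a family of partitions *)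

Definition hierarchy (X K : Type) (k : int -> X -> K) : Prop :=
  (forall x y, exists hi, forall i, hi <= i -> k i x = k i y) /\
  (forall x y, (forall i, k i x = k i y) -> x = y).

Definition top_scale (X K : Type) (k : int -> X -> K) (x y : X) : set int :=
  [set n | k n x <> k n y /\ forall i, n < i -> k i x = k i y].

(** The exponent is one above the top separating scale: there the points share a cell, whose
    diameter bounds their distance. The default of [xget] is not reached for distinct points of a
    hierarchy. *)
Definition hdist (R : realType) (X K : Type) (k : int -> X -> K) (x y : X) : R :=
  if `[< x = y >] then 0 else 2 ^ (xget 0 (top_scale k x y) + 1).

Lemma hierarchy_top (X K : Type) (k : int -> X -> K) (x y : X) :
  hierarchy k -> x <> y -> exists n, top_scale k x y n.
Proof.
move=> [hiP sepP] xy; have [hi hiE] := hiP x y.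
have [i0 i0P] : exists i0, k i0 x <> k i0 y.
  by apply: contrapT => /forallNP h; apply: xy; apply: sepP => i; exact: contrapT (h i).
(* The scales are searched downwards from [hi], so the least offset gives the top one. *)
have ex : exists n : nat, `[< k (hi - n%:Z) x <> k (hi - n%:Z) y >].
  exists `|hi - i0|%N; apply/asboolP.
  have i0hi : i0 <= hi by rewrite leNgt; apply/negP => /ltW/hiE.
  by rewrite gez0_abs ?subr_ge0// opprB addrC subrK.
case: (ex_minnP ex) => n /asboolP nP nmin; exists (hi - n%:Z); split => // i ni.
apply: contrapT => ine.
have ihi : i <= hi by rewrite leNgt; apply/negP => /ltW/hiE.
have : (n <= `|hi - i|)%N.
  by apply: nmin; apply/asboolP; rewrite gez0_abs ?subr_ge0// opprB addrC subrK.
lia.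
Qed.

Lemma hdistP (R : realType) (X K : Type) (k : int -> X -> K) (x y : X) :
  hierarchy k ->
  (x = y /\ hdist R k x y = 0) \/
  (exists2 n, top_scale k x y n & hdist R k x y = 2 ^ (n + 1)).
Proof.
move=> hk; rewrite /hdist; case: asboolP => [->|xy]; first by left.
have [n nP] := hierarchy_top hk xy.
by right; exists (xget 0 (top_scale k x y)) => //; exact: xgetPex (ex_intro _ n nP).
Qed.

(** The right-hand side is an intersection of equivalence relations, which is why [hdist] is an
    ultrametric without any nesting. *)
Lemma hdist_le (R : realType) (X K : Type) (k : int -> X -> K) (x y : X) (n : int) :
  hierarchy k ->
  hdist R k x y <= 2 ^ (n + 1) <-> (forall i, n < i -> k i x = k i y).
Proof.
move=> hk; have [[-> ->]|[m [mP mtop] ->]] := @hdistP R _ _ k x y hk.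
  by split => // _; rewrite exprz_ge0.
rewrite ler_eXz2l ?ltr1n// lerD2r; split => [mn i ni|h].
  by apply: mtop; exact: le_lt_trans ni.
by rewrite leNgt; apply/negP => /h.
Qed.

Lemma hdist_top (R : realType) (X K : Type) (k : int -> X -> K) (x y : X) (n : int) :
  hierarchy k -> top_scale k x y n -> hdist R k x y = 2 ^ (n + 1).
Proof.
move=> hk [nP ntop]; apply/eqP; rewrite eq_le (hdist_le R x y n hk).2//=.
have [[xy _]|[m [mP mtop] ->]] := @hdistP R _ _ k x y hk.
  by rewrite xy in nP.
rewrite ler_eXz2l ?ltr1n// lerD2r leNgt; apply/negP => /mtop; exact: nP.
Qed.

Lemma hdist_ge0 (R : realType) (X K : Type) (k : int -> X -> K) (x y : X) :
  0 <= hdist R k x y.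
Proof. by rewrite /hdist; case: ifP => // _; rewrite exprz_ge0. Qed.

Lemma hdistxx (R : realType) (X K : Type) (k : int -> X -> K) (x : X) :
  hdist R k x x = 0.
Proof. by rewrite /hdist; case: asboolP. Qed.

Lemma hdist_eq0 (R : realType) (X K : Type) (k : int -> X -> K) (x y : X) :
  hdist R k x y = 0 -> x = y.
Proof.
rewrite /hdist; case: asboolP => // _ /eqP; rewrite expfz_eq0.
by rewrite pnatr_eq0 andbF.
Qed.

Lemma hdistC (R : realType) (X K : Type) (k : int -> X -> K) (x y : X) :
  hierarchy k -> hdist R k x y = hdist R k y x.
Proof.
move=> hk; have [[-> _]//|[m [mP mtop] ->]] := @hdistP R _ _ k x y hk.
by apply/esym/hdist_top => //; split => [/esym//|i /mtop].
Qed.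

Lemma hdist_ultra (R : realType) (X K : Type) (k : int -> X -> K) (x y z : X) :
  hierarchy k ->
  hdist R k x z <= Num.max (hdist R k x y) (hdist R k y z).
Proof.
move=> hk; have [[<- _]|[n nP xyn]] := @hdistP R _ _ k x y hk.
  by rewrite le_max lexx orbT.
have [[<- _]|[m mP yzm]] := @hdistP R _ _ k y z hk; first by rewrite le_max lexx.
have maxE : Num.max (hdist R k x y) (hdist R k y z) = 2 ^ (Num.max n m + 1).
  rewrite xyn yzm; case: (lerP n m) => nm.
    by rewrite (max_idPr _)// ler_eXz2l ?ltr1n// lerD2r.
  by rewrite (max_idPl _)// ler_eXz2l ?ltr1n// lerD2r ltW.
rewrite maxE; apply/hdist_le => // i; rewrite gt_max => /andP[ni mi].
by rewrite nP.2// mP.2.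
Qed.

(** The parameters in the type let the metric structure on the fixed carrier [X] vary with the
    partitions, hence with the random outcome. *)
Definition hspace (R : realType) (X : choiceType) (K : Type)
  (k : int -> X -> K) (hk : hierarchy k) : Type := X.

HB.instance Definition _ (R : realType) (X : choiceType) (K : Type)
  (k : int -> X -> K) (hk : hierarchy k) := Choice.copy (hspace R hk) X.

Lemma hspace_triangle (R : realType) (X : choiceType) (K : Type)
    (k : int -> X -> K) (hk : hierarchy k) (y x z : hspace R hk) :
  hdist R k x z <= hdist R k x y + hdist R k y z.
Proof.
rewrite (le_trans (hdist_ultra R x y z hk))// ge_max lerDl lerDr.
by rewrite !hdist_ge0.
Qed.

HB.instance Definition _ (R : realType) (X : choiceType) (K : Type)
    (k : int -> X -> K) (hk : hierarchy k) :=
  @isMetric.Build R (hspace R hk) (@hdist R X K k) (@hdistxx R X K k)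
    (@hdist_eq0 R X K k) (fun x y => hdistC R x y hk)
    (@hspace_triangle R X K k hk).

Lemma hspace_2HST (R : realType) (X : choiceType) (K : Type)
    (k : int -> X -> K) (hk : hierarchy k) (t : seq (hspace R hk)) :
  t != [::] -> is_2HST [set` t].
Proof.
move=> t0.
have mP (x y : hspace R hk) : exists m : int, mdist x y = 0 \/ mdist x y = 2 ^ m.
  have [[_ xy]|[n _ xy]] := @hdistP R _ _ k x y hk; first by exists 0; left.
  by exists (n + 1); right.
pose m x y : int := projT1 (cid (mP x y)).
have mE x y : mdist x y = 0 \/ mdist x y = 2 ^ m x y := projT2 (cid (mP x y)).
pose B := (\max_(x <- t) \max_(y <- t) `|m x y|)%N.
have mB x y : x \in t -> y \in t -> (`|m x y| <= B)%N.
  move=> xt yt; apply: (@leq_trans (\max_(z <- t) `|m x z|)%N).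
    by rewrite (big_rem y yt)/= leq_maxl.
  by rewrite /B [leqRHS](big_rem x xt)/= leq_maxl.
(* The exponents from [-B] to [B] occupy the levels 1 to [B.*2.+1]; level 0 is the distance 0. *)
pose r n : R := if n is n'.+1 then 2 ^ (n'%:Z - B%:Z) else 0.
apply: (@finite_ultrametric_2HST R _ t r B.*2.+1) => //.
- by move=> x y z; exact: hdist_ultra.
- by case=> [|n] //=; rewrite exprz_ge0.
- case=> [|n] /=; first by rewrite mulr0 exprz_ge0.
  by rewrite -{1}[2]expr1z -expfzDr ?pnatr_eq0// (_ : 1 + _ = n.+1%:Z - B%:Z)//; lia.
- move=> x y xt yt; have := mB x y xt yt => mxyB.
  have [->|->] := mE x y; first by exists 0%N.
  exists (absz (m x y + B%:Z)).+1; first by lia.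
  by rewrite /r; congr (_ ^ _); lia.
Qed.

(** * Expected distances *)

Lemma exp2_unbounded (R : realType) (r : R) : exists n : nat, r <= 2 ^+ n.
Proof.
have [r0|r0] := lerP r 0; first by exists 0%N; rewrite (le_trans r0)// ler01.
exists (Num.bound r); rewrite (le_trans (ltW (archi_boundP (ltW r0))))//.
by rewrite -natrX ler_nat ltnW// ltn_expl.
Qed.

Lemma exp2_floor (R : realType) (l : R) :
  0 < l -> exists n : int, 2 ^ n < l <= 2 ^ (n + 1).
Proof.
move=> l0; have [N lN] := exp2_unbounded l; have [M lM] := exp2_unbounded (2 / l).
have two0 : (2 : R) != 0 by rewrite pnatr_eq0.
have ex : exists k : nat, l <= 2 ^ (k%:Z - M%:Z).
  by exists (N + M)%N; rewrite (_ : _ - _ = N%:Z)//; lia.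
case: (ex_minnP ex) => -[|k] lk kmin.
  (* Offset 0 is impossible: [l <= 2 ^ (- M)] contradicts [2 / l <= 2 ^+ M]. *)
  exfalso; move: lM; rewrite ler_pdivrMr// => lM.
  have := ler_wpM2r (exprn_ge0 M (ler0n R 2)) lk.
  by rewrite sub0r -invr_expz mulVf ?expf_neq0// mulrC; move: lM; lra.
exists (k%:Z - M%:Z); rewrite (_ : _ + 1 = k.+1%:Z - M%:Z) ?lk ?andbT; last by lia.
by rewrite ltNge; apply/negP => /kmin; rewrite ltnn.
Qed.

Lemma ln2_ge (R : realType) : 2^-1 <= ln (2 : R).
Proof.
have := @le_ln1Dx R (- 2^-1); rewrite (_ : 1 + - 2^-1 = 2^-1); last by field.
by rewrite lnV ?posrE//; lra.
Qed.

(** Only the [p] scales from [lo] on can be the top one, so the distance is a finite case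
    distinction on measurable events; [g] scans them from above. *)
Lemma hdist_measurable (R : realType) (disp : measure_display)
    (T : measurableType disp) (X K : Type) (k : T -> int -> X -> K) (x y : X)
    (lo : int) (p : nat) :
  (forall w, hierarchy (k w)) ->
  (forall w n, top_scale (k w) x y n -> lo <= n) ->
  (forall w i, lo + p%:Z <= i -> k w i x = k w i y) ->
  (forall i, measurable [set w | k w i x <> k w i y]) ->
  measurable_fun [set: T] (fun w => hdist R (k w) x y).
Proof.
move=> hk lo_le hi_le mk.
pose g := fix g (j : nat) (w : T) : R := if j is j'.+1 then
  if `[< k w (lo + j'%:Z) x <> k w (lo + j'%:Z) y >] then 2 ^ (lo + j'%:Z + 1)
  else g j' w else 0.
have mg j : measurable_fun [set: T] (g j).
  elim: j => [|j IH] /=; first exact: measurable_cst.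
  apply: measurable_fun_ifT => //.
  apply: (measurable_fun_bool true); rewrite setTI.
  rewrite (_ : _ @^-1` _ = [set w | k w (lo + j%:Z) x <> k w (lo + j%:Z) y])//.
  by apply/seteqP; split => w /= /asboolP.
have gE q w : (forall i, lo + q%:Z <= i -> k w i x = k w i y) ->
    hdist R (k w) x y = g q w.
  elim: q => [|q IH] /= above.
    have [[_ ->]//|[n nP _]] := @hdistP R _ _ (k w) x y (hk w).
    have [ne _] := nP; case: ne; apply: above; rewrite addr0; exact: lo_le nP.
  case: asboolP => [cut|/contrapT same].
    by apply: hdist_top => //; split => // i ?; apply: above; lia.
  apply: IH => i; rewrite le_eqVlt => /predU1P[<-//|?]; apply: above; lia.
rewrite (_ : (fun w => _) = g p)//.
by apply/funext => w; apply: gE; exact: hi_le.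
Qed.

(** The distance is at most the sum of [2 ^ (i + 1)] over the [p] scales [i] that separate the pair;
    each scale contributes at most [2 ^ (i + 1) * 2 ^ (- i) * e = 2 * e]. *)
Lemma hdist_expectation_le (R : realType) (disp : measure_display)
    (T : measurableType disp) (P : probability T R) (X K : Type)
    (k : T -> int -> X -> K) (x y : X) (lo : int) (p : nat) (e : R) :
  (forall w, hierarchy (k w)) ->
  (forall w n, top_scale (k w) x y n -> lo <= n) ->
  (forall w i, lo + p%:Z <= i -> k w i x = k w i y) ->
  (forall i, measurable [set w | k w i x <> k w i y]) ->
  (forall i, (P [set w | k w i x <> k w i y] <= (2 ^ (- i) * e)%:E)%E) ->
  ('E_P[fun w => hdist R (k w) x y] <= (p%:R * (2 * e))%:E)%E.
Proof.
move=> hk lo_le hi_le mk Pk.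
pose C (j : nat) := [set w | k w (lo + j%:Z) x <> k w (lo + j%:Z) y].
pose c (j : nat) : R := 2 ^ (lo + j%:Z + 1).
have c0 j : 0 <= c j by rewrite exprz_ge0.
have mh : measurable_fun [set: T] (fun w => hdist R (k w) x y) :=
  hdist_measurable hk lo_le hi_le mk.
have mC j : measurable_fun [set: T] (fun w => (c j * \1_(C j) w)%:E).
  by apply/measurable_EFinP; apply: measurable_funM => //; exact/measurable_indic/mk.
have term0 j w : (0 <= (c j * \1_(C j) w)%:E)%E.
  by rewrite lee_fin mulr_ge0.
rewrite unlock.
apply: (@le_trans _ _ (\int[P]_w \sum_(j < p) (c j * \1_(C j) w)%:E)%E).
  apply: ge0_le_integral => //.
  - by move=> w _; rewrite lee_fin hdist_ge0.
  - exact/measurable_EFinP.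
  - by apply: emeasurable_sum => j; exact: mC.
  - move=> w _; have [[_ ->]|[n nP ->]] := @hdistP R _ _ (k w) x y (hk w).
      by apply: sume_ge0 => j _; exact: term0.
    have lon := lo_le w n nP; have [nne ntop] := nP.
    have np : (absz (n - lo) < p)%N.
      rewrite ltnNge; apply/negP => pn; apply: nne; apply: hi_le; lia.
    have nE : n = lo + (absz (n - lo))%:Z by lia.
    rewrite (bigD1 (Ordinal np))//= indicE mem_set; last by rewrite /C /= -nE.
    rewrite mulr1 /c -nE leeDl//; apply: sume_ge0 => j _; exact: term0.
rewrite ge0_integral_sum//.
apply: (@le_trans _ _ (\sum_(j < p) (2 * e)%:E)%E); last first.
  by rewrite sumEFin lee_fin sumr_const card_ord [leRHS]mulr_natl.
apply: lee_sum => j _.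
rewrite (integralZl_indic measurableT (fun _ => C j)); first last.
- exact: mk.
- by move=> c_neg; have := c0 j; rewrite leNgt c_neg.
rewrite integral_indic ?setIT//; last exact: mk.
apply: (@le_trans _ _ ((c j)%:E * (2 ^ (- (lo + j%:Z)) * e)%:E)%E).
  apply: lee_wpmul2l; first by rewrite lee_fin.
  exact: Pk.
rewrite -EFinM lee_fin /c mulrA -expfzDr ?pnatr_eq0//.
by rewrite (_ : _ + 1 + _ = 1)//; lia.
Qed.

(** * Dyadic scales of a single partition *)

Lemma dyadic_hierarchy (R : realType) (d : nat) (K : Type) (N : 'rV[R]_d -> K) :
  (forall x y, N x = N y -> l2dist x y <= 1) ->
  (forall x y, l2dist x 0 <= 4^-1 /\ l2dist y 0 <= 4^-1 -> N x = N y) ->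
  hierarchy (fun (i : int) x => N ((2 : R) ^ (- i) *: x)).
Proof.
move=> near core; split.
  (* At large scales both points are shrunk into the core ball. *)
  move=> x y; have [n nP] := exp2_unbounded (4 * Num.max (l2dist x 0) (l2dist y 0)).
  exists n%:Z => i ni; apply: core.
  have small z : 4 * l2dist z 0 <= 2 ^+ n -> l2dist ((2 : R) ^ (- i) *: z) 0 <= 4^-1.
    move=> zn; rewrite -[0 in leLHS](scaler0 _ ((2 : R) ^ (- i))) l2distZ ?exprz_ge0//.
    rewrite -invr_expz ler_pdivrMl ?exprz_gt0// ler_pdivlMr// mulrC.
    by rewrite (le_trans zn)// exprnP ler_eXz2l ?ltr1n.
  split; apply: small; apply: le_trans nP; rewrite ler_wpM2l// le_max lexx ?orbT//.
move=> x y same; apply/eqP; rewrite -l2dist_eq0; apply/negP => /negP ne.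
have D0 : 0 < l2dist x y by rewrite lt_def ne l2dist_ge0.
(* Cells at scale [n] have diameter at most [2 ^ n < |x - y|], so this scale separates the
   points. *)
have [n /andP[nlt _]] := exp2_floor D0.
have := near _ _ (same n); rewrite l2distZ ?exprz_ge0// -invr_expz.
by rewrite ler_pdivrMl ?exprz_gt0// mulr1 leNgt nlt.
Qed.

Lemma dyadic_dominating (R : realType) (d : nat) (K : Type) (N : 'rV[R]_d -> K)
    (x y : 'rV[R]_d) :
  (forall x y, N x = N y -> l2dist x y <= 1) ->
  hierarchy (fun (i : int) x => N ((2 : R) ^ (- i) *: x)) ->
  l2dist x y <= hdist R (fun (i : int) x => N ((2 : R) ^ (- i) *: x)) x y.
Proof.
move=> near hk; have [[-> ->]|[n [_ top] ->]] := @hdistP R _ _ _ x y hk.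
  by rewrite le_eqVlt l2dist_eq0 eqxx.
have := near _ _ (top (n + 1) (ltrDl _ _)).
rewrite l2distZ ?exprz_ge0// -invr_expz ler_pdivrMl ?exprz_gt0// mulr1.
by apply.
Qed.

Lemma l2dist_le_max_dist (R : realType) (d : nat) (s : seq 'rV[R]_d) x y :
  x \in s -> y \in s -> l2dist x y <= max_dist s.
Proof.
move=> xs ys; apply: (bigmax_sup_seq 0 x) => //.
exact: (le_bigmax_seq 0 y).
Qed.

Lemma min_dist_le_l2dist (R : realType) (d : nat) (s : seq 'rV[R]_d) x y :
  x \in s -> y \in s -> x != y -> min_dist s <= l2dist x y.
Proof.
move=> xs ys xy; apply: (bigmin_inf_seq _ x) => //.
exact: (ge_bigmin_seq _ y).
Qed.

Lemma min_dist_gt0 (R : realType) (d : nat) (s : seq 'rV[R]_d) :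
  0 < max_dist s -> 0 < min_dist s.
Proof.
move=> M0; apply: lt_bigmin => // x _; apply: lt_bigmin => // y xy.
by rewrite lt_def l2dist_eq0 xy l2dist_ge0.
Qed.

Lemma dyadic_expectation_le (R : realType) (d : nat) (disp : measure_display)
    (T : measurableType disp) (P : probability T R) (K : Type)
    (N : T -> 'rV[R]_d -> K) (c M : R) (x y : 'rV[R]_d) :
  (forall w x y, N w x = N w y -> l2dist x y <= 1) ->
  (forall w x y, l2dist x 0 <= 4^-1 /\ l2dist y 0 <= 4^-1 -> N w x = N w y) ->
  (forall x y, measurable [set w | N w x <> N w y]) ->
  (forall x y, (P [set w | N w x <> N w y] <= (c * l2dist x y)%:E)%E) ->
  0 <= c -> x != y -> l2dist x 0 <= M -> l2dist y 0 <= M -> l2dist x y <= M ->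
  let k w (i : int) x := N w ((2 : R) ^ (- i) *: x) in
  measurable_fun [set: T] (fun w => hdist R (k w) x y) /\
  ('E_P[fun w => hdist R (k w) x y] <=
     (8 * c * (1 + ln (M / l2dist x y)) * l2dist x y)%:E)%E.
Proof.
move=> near core mN PN c0 xy xM yM lM k.
have l0 : 0 < l2dist x y by rewrite lt_def l2dist_eq0 xy l2dist_ge0.
have M0 : 0 < M by exact: lt_le_trans l0 lM.
have hk w : hierarchy (k w) by exact: (dyadic_hierarchy (near w) (core w)).
have [lo /andP[lol llo]] := exp2_floor l0.
have ex : exists p : nat, 4 * M <= 2 ^ (lo + p%:Z).
  have [p pP] := exp2_unbounded (4 * M / 2 ^ lo); exists p.
  by rewrite (addrC lo) expfzDr ?pnatr_eq0// -ler_pdivrMr ?exprz_gt0.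
case: (ex_minnP ex) => p Mp pmin.
have lo_le w n : top_scale (k w) x y n -> lo <= n.
  move=> [_ top]; have := near w _ _ (top (n + 1) (ltrDl _ _)).
  rewrite l2distZ ?exprz_ge0// -invr_expz ler_pdivrMl ?exprz_gt0// mulr1.
  move=> /(lt_le_trans lol).
  by rewrite ltr_eXz2l ?ltr1n// ltzD1.
have hi_le w i : lo + p%:Z <= i -> k w i x = k w i y.
  move=> pi; apply: core.
  have small z : l2dist z 0 <= M -> l2dist ((2 : R) ^ (- i) *: z) 0 <= 4^-1.
    move=> zM; rewrite -[0 in leLHS](scaler0 _ ((2 : R) ^ (- i))) l2distZ ?exprz_ge0//.
    rewrite -invr_expz ler_pdivrMl ?exprz_gt0// ler_pdivlMr// mulrC.
    apply: (@le_trans _ _ (4 * M)); first by rewrite ler_wpM2l.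
    by rewrite (le_trans Mp)// ler_eXz2l ?ltr1n.
  by split; exact: small.
have mk i : measurable [set w | k w i x <> k w i y] by exact: mN.
split; first exact: (hdist_measurable hk lo_le hi_le mk).
have Pk i : (P [set w | k w i x <> k w i y] <=
    (2 ^ (- i) * (c * l2dist x y))%:E)%E.
  by apply: le_trans (PN _ _) _; rewrite l2distZ ?exprz_ge0// mulrCA.
apply: le_trans (hdist_expectation_le hk lo_le hi_le mk Pk) _.
rewrite lee_fin.
have lnMl : 0 <= ln (M / l2dist x y) by rewrite ln_ge0// ler_pdivlMr// mul1r.
(* For positive [p], minimality gives [2 ^ (lo + p - 1) < 4 M], and [|x - y| <= 2 ^ (lo + 1)] turns
   this into [2 ^ p <= 2 ^ 4 * M / |x - y|]. *)
have pln : p%:R * ln 2 <= 4 * ln 2 + ln (M / l2dist x y).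
  case: p {Mp hi_le} pmin => [|p] pmin.
    by rewrite mul0r addr_ge0// mulr_ge0// ln_ge0// ler1n.
  have lt : 2 ^ (lo + p%:Z) < 4 * M.
    by rewrite ltNge; apply/negP => /pmin; rewrite ltnn.
  have : 2 ^+ p.+1 <= 2 ^+ 4 * (M / l2dist x y).
    rewrite mulrA ler_pdivlMr//.
    apply: (@le_trans _ _ (2 ^+ p.+1 * 2 ^ (lo + 1))); first by rewrite ler_wpM2l.
    rewrite (_ : 2 ^+ p.+1 * 2 ^ (lo + 1) = 2 ^+ 2 * 2 ^ (lo + p%:Z)).
      by move: lt; lra.
    by rewrite !expfzDr ?pnatr_eq0// expr1z -exprnP exprS; ring.
  rewrite -[X in is_true X -> _]ler_ln ?posrE ?mulr_gt0 ?invr_gt0 ?exprn_gt0//.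
  rewrite lnXn// lnM ?posrE ?divr_gt0 ?exprn_gt0// [X in X + _]lnXn//.
  by rewrite -[ln 2 *+ p.+1]mulr_natl -[ln 2 *+ 4]mulr_natl.
have h2 := ln2_ge R.
(* As [ln 2 >= 1/2], the number of scales is at most [4 + 2 ln (M / |x - y|)]. *)
have p4 : p%:R <= 4 * (1 + ln (M / l2dist x y)).
  have : (p%:R - 4) * ln 2 <= ln (M / l2dist x y) by rewrite mulrBl lerBlDl.
  have [p4|p4] := lerP (p%:R : R) 4; first by lra.
  have : (p%:R - 4) * 2^-1 <= (p%:R - 4) * ln 2 :> R.
    by rewrite ler_wpM2l// subr_ge0 ltW.
  by lra.
apply: (@le_trans _ _ (4 * (1 + ln (M / l2dist x y)) * (2 * (c * l2dist x y)))).
  by rewrite ler_wpM2r// mulr_ge0// mulr_ge0// ltW.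
by rewrite le_eqVlt; apply/orP; left; apply/eqP; ring.
Qed.

Theorem theorem4p1 (R : realType) :
  exists2 C : R, 0 < C &
    forall d : nat,
      exists (disp : measure_display) (Omega : measurableType disp)
             (P : probability Omega R) (F : Omega -> online_embedding R d),
        [/\ stochastic_online_embedding F,
            forall w : Omega, into_2HST (F w) &
            forall s : seq 'rV[R]_d,
              expected_distortion P F s
                (distortion_bound d C (aspect_ratio s))].
Proof.
(* The 8 comes from counting scales, [6 * pi + 4] from the unit partition. *)
exists (8 * (6 * pi + 4)).
  by rewrite mulr_gt0// ltr_wpDl// mulr_ge0// pi_ge0.
move=> d; have [disp [T [P [K [N HN]]]]] := random_partition_unit R d.
have near w x y : N w x = N w y -> l2dist x y <= 1 by have [+ _ _ _] := HN x y; apply.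
have core w x y : l2dist x 0 <= 4^-1 /\ l2dist y 0 <= 4^-1 -> N w x = N w y.
  by have [_ + _ _] := HN x y; apply.
have mN x y : measurable [set w | N w x <> N w y] by have [] := HN x y.
have PN x y : (P [set w | (N w x <> N w y)%type] <=
    ((6 * pi + 4) * Num.sqrt d%:R * l2dist x y)%:E)%E by have [] := HN x y.
pose k w (i : int) (x : 'rV[R]_d) := N w ((2 : R) ^ (- i) *: x).
have hk w : hierarchy (k w) by exact: (dyadic_hierarchy (near w) (core w)).
(* Later arrivals do not change the first point, so translating by it is online; the default 0
   concerns the empty input only. *)
pose emb w (s : seq 'rV[R]_d) (x : 'rV[R]_d) : hspace R (hk w) := x - head 0 s.
have emb_rcons w (s : seq 'rV[R]_d) (z x : 'rV[R]_d) :
    x \in s -> emb w (rcons s z) x = emb w s x by case: s.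
pose F w : online_embedding R d := OnlineEmbedding (@emb_rcons w).
have distB (x y z : 'rV[R]_d) : l2dist (x - z) (y - z) = l2dist x y.
  congr Num.sqrt; apply: eq_bigr => i _; rewrite !mxE; congr (_ ^+ 2); ring.
have c0 : 0 <= (6 * pi + 4) * Num.sqrt d%:R :> R.
  by rewrite mulr_ge0 ?sqrtr_ge0// addr_ge0// mulr_ge0// pi_ge0.
have main (s : seq 'rV[R]_d) x y : x \in s -> y \in s -> x != y ->
    measurable_fun [set: T] (fun w => emb_dist (F w) s x y) /\
    ('E_P[fun w => emb_dist (F w) s x y] <=
      (8 * ((6 * pi + 4) * Num.sqrt d%:R) *
         (1 + ln (max_dist s / l2dist x y)) * l2dist x y)%:E)%E.
  move=> xs ys xy; set h := head 0 s.
  have hs : h \in s by rewrite /h; case: (s) xs => //= a t _; exact: mem_head.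
  (* After the translation, norms are distances between input points. *)
  have dh z : z \in s -> l2dist (z - h) 0 <= max_dist s.
    by move=> zs; rewrite -(subrr h) distB l2dist_le_max_dist.
  have := @dyadic_expectation_le R d disp T P K N _ (max_dist s) (x - h) (y - h)
    near core mN PN c0.
  rewrite (inj_eq (addIr (- h))) distB.
  by apply => //; [exact: dh|exact: dh|exact: l2dist_le_max_dist].
have same (s : seq 'rV[R]_d) x w : emb_dist (F w) s x x = 0 by exact: mdistxx.
exists disp, T, P, F; split.
- split.
    move=> w s x y xs ys; rewrite -(distB x y (head 0 s)).
      exact: dyadic_dominating (near w) (hk w).
  move=> s x y xs ys; have [<-|xy] := eqVneq x y; last by have [] := main s x y xs ys xy.
  by under eq_fun do rewrite same; exact: measurable_cst.
- move=> w; split; first by move=> x y z; exact: hdist_ultra.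
  move=> s s0; have t0 : map (emb w s) s != [::] by case: (s) s0.
  suff <- : [set` map (emb w s) s] = [set emb w s x | x in [set` s]].
    exact: hspace_2HST t0.
  apply/seteqP; split => z /=.
    by move=> /mapP[x xs ->]; exists x.
  by case=> x xs <-; exact: map_f.
- move=> s x y xs ys; have [<-|xy] := eqVneq x y.
    under [X in expectation _ X]eq_fun do rewrite same.
    rewrite (_ : (fun=> 0) = cst 0)// expectation_cst lee_fin.
    by rewrite (eqP (_ : l2dist x x == 0)) ?mulr0// l2dist_eq0.
  have l0 : 0 < l2dist x y by rewrite lt_def l2dist_eq0 xy l2dist_ge0.
  have M0 : 0 < max_dist s by rewrite (lt_le_trans l0)// l2dist_le_max_dist.
  have m0 := min_dist_gt0 M0.
  apply: le_trans (main s x y xs ys xy).2 _; rewrite lee_fin /distortion_bound.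
  rewrite [8 * _ * (_ * _)]mulrA -[8 * _ * Num.sqrt _]mulrA.
  rewrite ler_wpM2r ?l2dist_ge0// ler_wpM2l//; first by rewrite mulr_ge0.
  (* Since [min_dist s <= |x - y|], the ratio in the logarithm is at most the aspect ratio. *)
  rewrite lerD2l ler_ln ?posrE ?divr_gt0// /aspect_ratio ler_wpM2l ?(ltW M0)//.
  by rewrite lef_pV2 ?posrE// min_dist_le_l2dist.
Qed.
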